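(* Let $k\ge 1$ and let $\mathcal{I}\subseteq\mathcal{P}([k])\setminus\{\varnothing\}$. For every $n\geq 2$ and every $m\geq\sum_{I\in\mathcal{I}}(|I|-1)$, the $k$-configuration $\chi_{\mathcal{I}}$ is realizable in $\mathbb{F}_n\times\mathbb{Z}^m$.
   Context: $\mathbb{F}_n$ is the free group of rank $n$ and $\mathbb{Z}^m$ the free-abelian group of rank $m$. For $k\ge 1$, $[k]=\{1,\ldots,k\}$ and $\mathcal{P}([k])$ is its power set. A $k$-configuration is a map $\chi\colon\mathcal{P}([k])\setminus\{\varnothing\}\to\{0,1\}$; for $\mathcal{I}\subseteq\mathcal{P}([k])\setminus\{\varnothing\}$, $\chi_{\mathcal{I}}$ is the $k$-configuration with $\chi_{\mathcal{I}}(I)=1$ if $I\in\mathcal{I}$ and $\chi_{\mathcal{I}}(I)=0$ otherwise (every $k$-configuration is of this form). Subgroups $H_1,\ldots,H_k$ (possibly with repetitions) of a group $G$ realize $\chi$ if, for every nonempty $I\subseteq[k]$, the intersection $\bigcap_{i\in I}H_i$ is finitely generated when $\chi(I)=0$ and not finitely generated when $\chi(I)=1$. The configuration $\chi$ is realizable in $G$ if some $k$ subgroups of $G$ realize it. *)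

(* Defs.v *)
From HB Require Import structures.
From mathcomp Require Import all_boot all_order all_algebra.
From mathcomp Require Import boolp classical_sets cardinality.

Set Implicit Arguments.
Unset Strict Implicit.
Unset Printing Implicit Defensive.

Local Open Scope group_scope.

(* The free group on X, as the set of reduced words in the letters (x, b),
   where (x, false) stands for x and (x, true) for its formal inverse. *)
Section FreeGroup.
Variable X : choiceType.

Local Notation letter := (X * bool)%type.
Implicit Types (a b : letter) (u v w : seq letter).

Definition flip (a : letter) : letter := (a.1, ~~ a.2).

Definition reduced w : bool := sorted (fun a b => b != flip a) w.

Definition push a w : seq letter :=
  if w is b :: w' then if b == flip a then w' else a :: w else [:: a].

Definition reduce w : seq letter := foldr push [::] w.

Lemma flipK : involutive flip.
Proof. by case=> x b; rewrite /flip /= negbK. Qed.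

Lemma push_reduced a w : reduced w -> reduced (push a w).
Proof.
case: w => //= b w; case: ifP => [_|/negbT ab] bw; last by rewrite /= ab.
exact: path_sorted bw.
Qed.

Lemma foldr_push_reduced u v : reduced v -> reduced (foldr push v u).
Proof. by move=> rv; elim: u => //= a u; apply: push_reduced. Qed.

Lemma reduce_reduced w : reduced (reduce w).
Proof. exact: foldr_push_reduced. Qed.

Lemma reduce_id w : reduced w -> reduce w = w.
Proof.
elim: w => //= a w IH aw; rewrite IH; last exact: path_sorted aw.
by case: w aw {IH} => //= b w /andP[/negbTE-> _].
Qed.

Lemma push_flip a w : reduced w -> push (flip a) (push a w) = w.
Proof.
case: w => [|b w]; first by rewrite /= flipK eqxx.
rewrite /=; case: eqP => [-> aw|_ _]; last by rewrite /= flipK eqxx.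
by case: w aw => //= c w /andP[/negbTE-> _].
Qed.

Lemma foldr_push_push a w v : reduced w -> reduced v ->
  foldr push v (push a w) = push a (foldr push v w).
Proof.
move=> rw rv; case: w rw => //= b w bw; case: eqP => [->|//].
by have := push_flip (flip a) (foldr_push_reduced w rv); rewrite flipK.
Qed.

Lemma foldr_push_cat u v w : reduced v -> reduced w ->
  foldr push w (foldr push v u) = foldr push (foldr push w v) u.
Proof.
move=> rv rw; elim: u => //= a u IH.
by rewrite foldr_push_push ?foldr_push_reduced // IH.
Qed.

Definition winv w : seq letter := rev (map flip w).

Lemma winvK : involutive winv.
Proof. by move=> w; rewrite /winv map_rev revK mapK //; apply: flipK. Qed.

Lemma winv_reduced w : reduced w -> reduced (winv w).
Proof.
rewrite /winv /reduced rev_sorted sorted_map; apply: sub_sorted => a b /=.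
by apply: contraNN => /eqP->; rewrite flipK.
Qed.

Lemma foldr_push_winv u v : reduced v -> foldr push (foldr push v u) (winv u) = v.
Proof.
move=> rv; elim: u => //= a u IH.
by rewrite /winv /= rev_cons foldr_rcons push_flip ?foldr_push_reduced.
Qed.

Definition free_group : Type := {w : seq letter | reduced w}.
HB.instance Definition _ := Choice.on free_group.
Implicit Types x y z : free_group.

Definition free_one : free_group := exist (fun w => reduced w) [::] isT.
Definition free_inv x : free_group :=
  exist (fun w => reduced w) (winv (val x)) (winv_reduced (valP x)).
Definition free_mul x y : free_group :=
  exist (fun w => reduced w) (reduce (val x ++ val y))
        (reduce_reduced (val x ++ val y)).

Lemma val_free_mul x y : val (free_mul x y) = foldr push (val y) (val x).
Proof. by rewrite /= /reduce foldr_cat -/(reduce _) reduce_id // (valP y). Qed.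

Lemma free_mulA : associative free_mul.
Proof.
move=> x y z; apply: val_inj; rewrite !val_free_mul.
by rewrite foldr_push_cat // ?(valP y) ?(valP z).
Qed.

Lemma free_mul1 : left_id free_one free_mul.
Proof. by move=> x; apply: val_inj; rewrite val_free_mul. Qed.

Lemma free_mulr1 : right_id free_one free_mul.
Proof. by move=> x; apply: val_inj; rewrite val_free_mul; apply/reduce_id/valP. Qed.

Lemma free_mulV : left_inverse free_one free_inv free_mul.
Proof.
move=> x; apply: val_inj; rewrite val_free_mul /=.
by rewrite -[X in foldr _ X _](reduce_id (valP x)) foldr_push_winv.
Qed.

Lemma free_mulrV : right_inverse free_one free_inv free_mul.
Proof.
move=> x; rewrite -[X in free_mul X _](_ : free_inv (free_inv x) = x) ?free_mulV //.
by apply: val_inj; rewrite /= winvK.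
Qed.

HB.instance Definition _ := isGroup.Build free_group
  free_mulA free_mul1 free_mulr1 free_mulV free_mulrV.

Definition free_gen (t : X) : free_group :=
  exist (fun w => reduced w) [:: (t, false)] isT.

(* The universal property, with basis free_gen. *)
Lemma free_group_universal (G : groupType) (f : X -> G) :
  exists! phi : free_group -> G,
    {morph phi : x y / x * y} /\ (forall t, phi (free_gen t) = f t).
Proof.
pose ev a : G := if a.2 then (f a.1)^-1 else f a.1.
pose phi x : G := foldr (fun a g => ev a * g) 1 (val x).
have evF a : ev (flip a) = (ev a)^-1.
  by rewrite /ev /flip /=; case: a.2; rewrite /= ?invgK.
have phiP a w : foldr (fun a g => ev a * g) 1 (push a w)
    = ev a * foldr (fun a g => ev a * g) 1 w.
  by case: w => //= b w; case: eqP => //= ->; rewrite evF mulVKg.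
exists phi; split.
  split=> [x y|t]; last by rewrite /phi /= mulg1.
  rewrite /phi -[x * y]/(free_mul x y) val_free_mul.
  by elim: (val x) => [|a w IH] /=; rewrite ?mul1g // phiP IH mulgA.
move=> psi [psiM psiG]; apply/funext => -[w rw].
have psi1 : psi 1 = 1 by apply: (mulgI (psi 1)); rewrite -psiM !mulg1.
have psiE t (b : bool) : psi (exist (fun w => reduced w) [:: (t, b)] isT) = ev (t, b).
  case: b; last by rewrite /ev -psiG; congr psi; apply: val_inj.
  apply: (mulgI (psi (free_gen t))); rewrite -psiM /ev /= -psiG mulgV -psi1.
  by congr psi; apply: val_inj; rewrite [LHS]val_free_mul /= /flip eqxx.
rewrite /phi /=; elim: w rw => [|[t b] w IH] rw.
  by rewrite -psi1; congr psi; apply: val_inj.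
have rw' : reduced w := path_sorted rw.
rewrite /= (IH rw') -psiE -psiM; congr psi.
apply: val_inj; rewrite [LHS]val_free_mul /=.
by case: w rw {IH rw'} => //= c w /andP[/negbTE-> _].
Qed.

End FreeGroup.

Section Subgroups.
Variable G : groupType.
Local Open Scope classical_set_scope.

Definition subgroup (H : set G) : Prop := group_closed [in H].

Definition generated (A : set G) : set G := smallest subgroup A.

Definition finitely_generated (H : set G) : Prop :=
  exists2 A : set G, finite_set A & generated A = H.

End Subgroups.

Definition nonempty_subset (k : nat) : Type := {I : {set 'I_k} | I != finset.set0}.
HB.instance Definition _ k := Finite.on (nonempty_subset k).

Definition configuration (k : nat) : Type := nonempty_subset k -> bool.

Definition chi k (II : {set nonempty_subset k}) : configuration k :=
  fun I => I \in II.

Definition realizes (G : groupType) k (H : 'I_k -> set G)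
    (c : configuration k) : Prop :=
  forall I : nonempty_subset k,
    let HI := (\bigcap_(i in [set` val I]) H i)%classic in
    if c I then ~ finitely_generated HI else finitely_generated HI.

Definition realizable (G : groupType) k (c : configuration k) : Prop :=
  exists2 H : 'I_k -> set G, (forall i, subgroup (H i)) & realizes H c.

(* F_n x Z^m; the additive group Z^m is turned into a multiplicative one. *)
Definition FZ (n m : nat) : groupType :=
  (free_group 'I_n * Algebra.to_multiplicative 'rV[int]_m)%type.

(* Main.v *)
Require Import Defs.
From mathcomp Require Import all_boot all_order all_algebra.
From mathcomp Require Import boolp classical_sets cardinality.

(** Let x and y be two of the free generators. For pairwise distinct heights
    the conjugates y^h x y^-h form a basis of the subgroup they generate; take
    one such element t_I for every nonempty subset I of the indices, and the
    element x itself, at height 0, as one more. The coordinates of Z^m are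
    distributed so that every I in II owns |I| - 1 of them, one for each
    element of I other than a chosen one, the tip of I. The subgroup H_i
    consists of the pairs (w, v) where w lies in the subgroup generated by x
    and the t_I with I containing i, and where for every I in II containing i
    one linear equation holds: if i is the tip of I, the sum of the
    coordinates owned by I equals the exponent of t_I in w; otherwise the
    coordinate owned by (I, i) vanishes.

    The intersection over J then only involves the t_I with I containing J.
    If I in II is not contained in J, the coordinate of an element of I
    outside J, or the absence of the equation of the tip, leaves the equations
    of I solvable in v for every w; if I in II is strictly contained in J,
    then t_I does not occur at all and v = 0 does. Hence, when J is not in II,
    the intersection projects onto the group generated by x and the t_I with I
    containing J, and is finitely generated because the kernel of this
    projection is a subgroup of Z^m ([bigcap_witness_fg]). When J is in II,
    the equations of J force all its coordinates, and therefore the exponent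
    of t_J, to vanish; the intersection projects onto the kernel of this
    exponent in a free group of rank at least 2, which is not finitely
    generated ([bigcap_witness_not_fg]).

    To avoid the theory of bases of subgroups, words are read as paths in a
    graph: a half-line of heights on which y moves up, with a loop labelled x
    at each allowed height (a comb). The subgroup above is the set of reduced
    words that label closed paths at height 0 using allowed loops only, so
    that intersecting subgroups means intersecting sets of allowed loops. A
    second component of the state, the load, records the exponents of the
    t_I. Bounding the load of t_J along the path by M yields an increasing
    chain of subgroups which exhausts the intersection over J without ever
    containing it, and this refutes finite generation
    ([union_of_chain_not_fg]). *)

Set Implicit Arguments.
Unset Strict Implicit.
Unset Printing Implicit Defensive.

Import Order.TTheory GRing.Theory Num.Theory.
Local Open Scope group_scope.
Local Open Scope classical_set_scope.

Local Notation mult := Algebra.to_multiplicative.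

(** * Generation of subgroups *)

Section Generation.
Variable G : groupType.
Implicit Types (A B H K : set G) (x y : G).

Lemma subgroupP H :
  subgroup H <-> [/\ H 1, forall x, H x -> H x^-1 & forall x y, H x -> H y -> H (x * y)].
Proof.
split=> [HG|[H1 HV HM]].
  split=> [|x Hx|x y Hx Hy]; apply: set_mem.
  - exact: HG.1.
  - exact: (group_closedV HG) (mem_set Hx).
  - exact: (group_closedM HG) (mem_set Hx) (mem_set Hy).
split=> [|x y /set_mem Hx /set_mem Hy]; apply: mem_set => //.
exact: HM Hx (HV _ Hy).
Qed.

Lemma subgroup1 H : subgroup H -> H 1.
Proof. by case/subgroupP. Qed.

Lemma subgroupV H x : subgroup H -> H x -> H x^-1.
Proof. by case/subgroupP => _ HV _; apply: HV. Qed.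

Lemma subgroupM H x y : subgroup H -> H x -> H y -> H (x * y).
Proof. by case/subgroupP => _ _ HM; apply: HM. Qed.

Lemma subgroup_bigcap (T : Type) (D : set T) (H : T -> set G) :
  (forall i, D i -> subgroup (H i)) -> subgroup (\bigcap_(i in D) H i).
Proof.
move=> HG; apply/subgroupP; split=> [i Di|x Hx i Di|x y Hx Hy i Di].
- exact: subgroup1 (HG i Di).
- by apply: (subgroupV (HG i Di)); apply: Hx.
- by apply: (subgroupM (HG i Di)); [apply: Hx|apply: Hy].
Qed.

Lemma subgroupI H K : subgroup H -> subgroup K -> subgroup (H `&` K).
Proof.
move=> HG KG; apply/subgroupP; split=> [|x [Hx Kx]|x y [Hx Kx] [Hy Ky]].
- by split; apply: subgroup1.
- by split; apply: subgroupV.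
- by split; apply: subgroupM.
Qed.

Lemma subgroup_generated A : subgroup (generated A).
Proof.
rewrite /generated /smallest.
by apply: (subgroup_bigcap (H := id)) => B [].
Qed.

Lemma mem_generated A x : A x -> generated A x.
Proof. exact: sub_gen_smallest. Qed.

Lemma generated_sub A H : subgroup H -> A `<=` H -> generated A `<=` H.
Proof. exact: smallest_sub. Qed.

Lemma finitely_generatedP A H :
  finite_set A -> subgroup H -> A `<=` H -> H `<=` generated A ->
  finitely_generated H.
Proof.
move=> Afin HG AH HA; exists A => //.
by apply/seteqP; split=> //; apply: generated_sub.
Qed.

(** A finite generating set of H would lie in a single member of the chain, and
    so would H. *)
Lemma union_of_chain_not_fg H (U : nat -> set G) :
  (forall i, subgroup (U i)) -> (forall i j, (i <= j)%N -> U i `<=` U j) ->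
  H `<=` \bigcup_i U i -> (forall i, ~ H `<=` U i) -> ~ finitely_generated H.
Proof.
move=> UG Umono HU HnU [A Afin AH].
suff [N AU] : exists N, A `<=` U N.
  by apply: (HnU N); rewrite -AH; apply: generated_sub.
have {}HU : A `<=` \bigcup_i U i.
  by move=> x /mem_generated; rewrite AH; apply: HU.
have /boolp.choice[f fU] : forall x, exists i, A x -> U i x.
  move=> x; have [Ax|nAx] := pselect (A x); last by exists 0.
  by have [i _ Ux] := HU x Ax; exists i.
have /finite_seqP[s fs] := finite_image f Afin.
exists (\max_(i <- s) i) => x Ax; apply: (Umono (f x)); last exact: fU.
apply: leq_bigmax_seq => //.
have : (f @` A) (f x) by exists x.
by rewrite fs.
Qed.
End Generation.

(** Generators of the kernel together with lifts of generators of the image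
    generate: an element agrees up to the kernel with a product of lifts. *)
Lemma finitely_generated_extension (G Q : groupType) (f : G -> Q) (H : set G) :
  {morph f : x y / x * y} -> subgroup H ->
  finitely_generated (f @` H) -> finitely_generated (H `&` f @^-1` [set 1]) ->
  finitely_generated H.
Proof.
move=> fM HG [B Bfin BH] [C Cfin CK].
have f1 : f 1 = 1 by apply: (mulgI (f 1)); rewrite -fM !mulg1.
have fV x : f x^-1 = (f x)^-1.
  by apply: (mulgI (f x)); rewrite -fM !mulgV.
have /boolp.choice[g gH] : forall b, exists x, B b -> H x /\ f x = b.
  move=> b; have [Bb|nBb] := pselect (B b); last by exists 1.
  have: (f @` H) b by rewrite -BH; apply: mem_generated.
  by move=> [x Hx <-]; exists x.
have KC x : C x -> H x /\ f x = 1.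
  by move=> /mem_generated; rewrite CK.
apply: (@finitely_generatedP _ (g @` B `|` C)) => //.
- by rewrite finite_setU; split=> //; apply: finite_image.
- by move=> x [[b Bb <-]|/KC[]//]; case: (gH b Bb).
set D := _ `|` C; move=> x Hx.
have DG : subgroup (generated D) := subgroup_generated D.
have DH : generated D `<=` H.
  by apply: generated_sub => // y [[b Bb <-]|/KC[]//]; case: (gH b Bb).
have [y Dy fy] : (f @` generated D) (f x).
  have: generated B (f x) by rewrite BH; exists x.
  apply: (generated_sub (H := f @` generated D)).
    apply/subgroupP; split=> [|_ [u Du <-]|_ _ [u Du <-] [v Dv <-]].
    - by exists 1; [exact: subgroup1 DG | exact: f1].
    - by exists u^-1; [exact: subgroupV DG Du | exact: fV].
    - by exists (u * v); [exact: subgroupM DG Du Dv | exact: fM].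
  move=> b Bb; exists (g b); last by case: (gH b Bb).
  by apply: mem_generated; left; exists b.
rewrite -[x](mulVKg y); apply: (subgroupM DG Dy).
have: (H `&` f @^-1` [set 1]) (y^-1 * x).
  split; last by rewrite /= fM fV fy mulVg.
  exact: subgroupM HG (subgroupV HG (DH _ Dy)) Hx.
rewrite -CK; apply: (generated_sub DG).
by move=> z Cz; apply: mem_generated; right.
Qed.

Lemma finitely_generated_trivial (G : groupType) (H : set G) :
  subgroup H -> H `<=` [set 1] -> finitely_generated H.
Proof.
move=> HG H1; apply: (@finitely_generatedP _ set0) => // x /H1 ->.
exact: subgroup1 (subgroup_generated _).
Qed.

Lemma subgroup_image (G Q : groupType) (f : G -> Q) (H : set G) :
  {morph f : x y / x * y} -> subgroup H -> subgroup (f @` H).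
Proof.
move=> fM HG; have f1 : f 1 = 1 by apply: (mulgI (f 1)); rewrite -fM !mulg1.
apply/subgroupP; split=> [|_ [u Hu <-]|_ _ [u Hu <-] [v Hv <-]].
- by exists 1; [exact: subgroup1 HG | exact: f1].
- exists u^-1; first exact: subgroupV HG Hu.
  by apply: (mulgI (f u)); rewrite -fM !mulgV.
- by exists (u * v); [exact: subgroupM HG Hu Hv | exact: fM].
Qed.

Lemma subgroup_kernel (G Q : groupType) (f : G -> Q) :
  {morph f : x y / x * y} -> subgroup (f @^-1` [set 1]).
Proof.
move=> fM; have f1 : f 1 = 1 by apply: (mulgI (f 1)); rewrite -fM !mulg1.
apply/subgroupP; split=> [//|x /= x1|x y /= x1 y1].
- by apply: (mulgI (f x)); rewrite -fM mulgV x1 mulg1.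
- by rewrite fM x1 y1 mulg1.
Qed.

(** * Subgroups of free-abelian groups *)

Lemma subgroup_mulrz (V : zmodType) (H : set (mult V)) (v : V) (q : int) :
  subgroup H -> H v -> H (v *~ q)%R.
Proof.
move=> HG Hv; have HvN k : H (v *+ k)%R.
  elim: k => [|k IH]; first exact: subgroup1 HG.
  by rewrite mulrS; exact: subgroupM HG Hv IH.
by case: q => k; [exact: HvN | exact: subgroupV HG (HvN k.+1)].
Qed.

(** The least positive element of H generates it, by Euclidean division. *)
Lemma finitely_generated_int (H : set (mult int)) :
  subgroup H -> finitely_generated H.
Proof.
move=> HG; pose P d := (0 < d)%N && `[< H (Posz d) >].
have HN (z : int) : H z -> H (Posz `|z|%N).
  by case: z => k //= Hk; exact: subgroupV HG Hk.
have [exP|nexP] := pselect (exists d, P d); last first.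
  apply: finitely_generated_trivial => // z /HN Hz.
  have : ~~ P `|z|%N by apply/negP => Pz; apply: nexP; exists `|z|%N.
  by rewrite /P absz_gt0 negb_and negbK => /orP[/eqP//|/asboolPn].
case: (ex_minnP exP) => d /andP[d0 /asboolP Hd] dmin.
apply: (@finitely_generatedP _ [set (Posz d : mult int)]) => //.
  by move=> _ ->.
move=> z Hz.
have zE : z = (Posz d *~ (z %/ d)%Z + (z %% d)%Z)%R.
  by rewrite -mulrzr intz mulrC -divz_eq.
have Hr : H (z %% d)%Z.
  have -> : (z %% d)%Z = (- (Posz d *~ (z %/ d)%Z) + z)%R.
    by rewrite {3}zE addKr.
  exact: subgroupM HG (subgroupV HG (subgroup_mulrz _ HG Hd)) Hz.
have r0 : (z %% d)%Z = 0%R.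
  apply/eqP; rewrite -absz_eq0 -leqn0 leqNgt; apply/negP => r0.
  have : (d <= `|(z %% d)%Z|)%N by apply: dmin; rewrite /P r0; exact/asboolP/HN.
  by rewrite leqNgt -ltz_nat gez0_abs ?modz_ge0 ?ltz_pmod // -lt0n.
rewrite zE r0 addr0.
by apply: (subgroup_mulrz _ (subgroup_generated _)); apply: mem_generated.
Qed.

(** Induction on the number d of coordinates that may be nonzero: reading the
    last of them is a morphism to the integers with kernel the previous stage. *)
Lemma finitely_generated_row m (H : set (mult 'rV[int]_m)) :
  subgroup H -> finitely_generated H.
Proof.
move=> HG; pose K d := H `&` [set v | forall j : 'I_m, (d <= j)%N -> (v : 'rV__) ord0 j = 0%R].
have KG d : subgroup (K d).
  apply/subgroupP; split=> [|v [Hv v0]|v w [Hv v0] [Hw w0]]; split.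
  - exact: subgroup1 HG.
  - by move=> j _; rewrite mxE.
  - exact: subgroupV HG Hv.
  - by move=> j /v0 /= vj; rewrite [LHS]mxE vj oppr0.
  - exact: subgroupM HG Hv Hw.
  - by move=> j dj; rewrite [LHS]mxE (v0 j) // (w0 j).
have {1}-> : H = K m.
  by apply/seteqP; split=> [v Hv|v []//]; split=> // j; rewrite leqNgt ltn_ord.
have : (m <= m)%N by [].
elim: {-2 3}m => [|d IH] dm.
  apply: finitely_generated_trivial => // v [_ v0].
  by apply/rowP => j; rewrite mxE v0.
pose f (v : mult 'rV[int]_m) : mult int := (v : 'rV__) ord0 (Ordinal dm).
have fM : {morph f : x y / x * y} by move=> x y; rewrite /f [LHS]mxE.
apply: (finitely_generated_extension fM (KG _)).
  exact/finitely_generated_int/subgroup_image.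
suff -> : K d.+1 `&` f @^-1` [set 1] = K d by apply: IH; exact: ltnW.
apply/seteqP; split=> [v [[Hv v0] fv]|v [Hv v0]].
  split=> // j; rewrite leq_eqVlt => /predU1P[dj|/v0//].
  by rewrite -[RHS]fv /f; congr (_ _ _); apply/val_inj.
split; last exact: v0.
by split=> // j /ltnW /v0.
Qed.

(** The elements of H with trivial first component form a group isomorphic to
    a subgroup of Z^m, so only the first projection can be an obstruction. *)
Lemma finitely_generated_times_row (F : groupType) m
    (H : set (F * mult 'rV[int]_m)%type) :
  subgroup H -> finitely_generated (fst @` H) -> finitely_generated H.
Proof.
move=> HG Hfst; apply: (@finitely_generated_extension _ _ fst) => //.
have KG : subgroup (H `&` fst @^-1` [set 1]).
  exact: subgroupI HG (subgroup_kernel _).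
apply: (@finitely_generated_extension _ _ snd) => //.
  exact/finitely_generated_row/subgroup_image.
apply: finitely_generated_trivial; first exact: subgroupI KG (subgroup_kernel _).
by move=> [w v] [[_ /= ->] /= ->].
Qed.

(** * Words and walks *)

(** A partial automaton on signed letters: [step] is total, but only the edges
    satisfying [ok] may be used. The condition [okV] says that an edge can be
    walked back along the inverse letter, which is what makes walks insensitive
    to free reduction. *)
Section Walks.
Variables (X : choiceType) (S : Type).
Variables (step : S -> X * bool -> S) (ok : S -> X * bool -> bool).
Hypothesis okV : forall p a, ok p a ->
  ok (step p a) (flip a) /\ step (step p a) (flip a) = p.
Implicit Types (p : S) (a : X * bool) (u v w : seq (X * bool)).

Fixpoint walk p w : bool :=
  if w is a :: w' then ok p a && walk (step p a) w' else true.

Lemma walk_cat p u v : walk p (u ++ v) = walk p u && walk (foldl step p u) v.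
Proof. by elim: u p => //= a u IH p; rewrite IH andbA. Qed.

Lemma walk_push p a w : walk p (a :: w) ->
  walk p (push a w) /\ foldl step p (push a w) = foldl step p (a :: w).
Proof.
case: w => //= b w /and3P[pa pb pw]; case: eqP => [bE|_] /=.
  by subst b; move: pw; rewrite !(okV pa).2.
by rewrite pa pb pw.
Qed.

Lemma walk_foldr_push p u v : walk p u -> walk (foldl step p u) v ->
  walk p (foldr (@push X) v u) /\
  foldl step p (foldr (@push X) v u) = foldl step (foldl step p u) v.
Proof.
elim: u p => //= a u IH p /andP[pa pu] pv; have [wu eu] := IH _ pu pv.
by have [|? ->] := @walk_push p a (foldr (@push X) v u); rewrite /= ?pa ?wu ?eu.
Qed.

Lemma walk_winv p u : walk p u ->
  walk (foldl step p u) (winv u) /\ foldl step (foldl step p u) (winv u) = p.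
Proof.
elim: u p => //= a u IH p /andP[pa pu]; have [wu eu] := IH _ pu.
rewrite /winv map_cons rev_cons -cats1 walk_cat foldl_cat -/(winv u) wu eu /=.
by have [-> ->] := okV pa.
Qed.

End Walks.

Section Letters.
Variable X : choiceType.

Definition free_letter (a : X * bool) : free_group X :=
  if a.2 then (free_gen a.1)^-1 else free_gen a.1.

Definition free_word (w : seq (X * bool)) : free_group X :=
  foldr (fun a g => free_letter a * g) 1 w.

Lemma val_free_letter a : val (free_letter a) = [:: a].
Proof. by case: a => t []. Qed.

Lemma free_word_cat (u v : seq (X * bool)) :
  free_word (u ++ v) = free_word u * free_word v.
Proof. by elim: u => [|a u IH] /=; rewrite ?mul1g // IH mulgA. Qed.

Lemma free_word_nseq j (a : X * bool) : free_word (nseq j a) = free_letter a ^+ j.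
Proof. by elim: j => //= j ->; rewrite expgS. Qed.

Lemma val_free_word (w : seq (X * bool)) : val (free_word w) = reduce w.
Proof. by elim: w => //= a w <-; rewrite [LHS]val_free_mul val_free_letter. Qed.

Lemma free_word_val (g : free_group X) : free_word (val g) = g.
Proof.
by apply: val_inj; rewrite val_free_word reduce_id // (valP g).
Qed.

(** Used to check that a product of powers of letters is reduced. The default
    value of head is a itself, which never cancels with a, so that the second
    hypothesis is automatic for an empty w. *)
Lemma reduced_nseq_cat j (a : X * bool) (w : seq (X * bool)) : reduced w ->
  head a w != flip a -> reduced (nseq j a ++ w).
Proof.
move=> rw wa; elim: j => //= j IH.
case: j IH => [|j] /= IH; last by rewrite IH /flip /eq_op /=; case: a.2; rewrite /= ?andbF.
by case: w rw wa {IH} => //= b w -> ->.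
Qed.
End Letters.

(** * The comb *)

Section Comb.
Variables (X : choiceType) (x y : X).
Variables (V : zmodType) (wt : nat -> V).
Implicit Types (A : pred nat) (B : pred V) (p : nat * V).

(** A state is a height and a load in V. The letter y raises the height, and
    passing the loop x at height h adds [wt h] to the load. Only the edges
    accepted by [comb_ok] matter: the letters x and y, with the loops at the
    heights in A, no descent below height 0, and both loads in B. *)
Definition comb_step p (a : X * bool) : nat * V :=
  if a.1 == x then (p.1, if a.2 then p.2 - wt p.1 else p.2 + wt p.1)%R
  else (if a.2 then p.1.-1 else p.1.+1, p.2).

Definition comb_ok A B p a : bool :=
  [&& if a.1 == x then A p.1 else (a.1 == y) && (a.2 ==> (0 < p.1)%N),
      B p.2 & B (comb_step p a).2].

Lemma comb_okV A B p a : comb_ok A B p a ->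
  comb_ok A B (comb_step p a) (flip a) /\
  comb_step (comb_step p a) (flip a) = p.
Proof.
case: p a => h c [t b] /and3P[] /=; rewrite /comb_ok /comb_step /=.
case: eqP => [_ Ah Bc Bs|_ /andP[/eqP-> hb] Bc _] /=.
  by case: b Bs => /= Bs; rewrite ?subrK ?addrK Ah Bc Bs.
by case: b hb => /= hb; rewrite ?eqxx Bc ?prednK.
Qed.

Definition comb_walk A B := walk comb_step (comb_ok A B).
Definition comb_end := foldl comb_step.

Lemma comb_walk_sub A A' B B' p w :
  {subset A <= A'} -> {subset B <= B'} ->
  comb_walk A B p w -> comb_walk A' B' p w.
Proof.
move=> AA' BB'; elim: w p => //= a w IH p /andP[/and3P[ap Bp Bs] /IH->].
rewrite andbT; apply/and3P; split; last exact: (BB' _ Bs).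
  by move: ap; case: ifP => // _; apply: AA'.
exact: (BB' _ Bp).
Qed.

Lemma comb_walk_forall (I : finType) (J : {set I}) (A : I -> pred nat) B p w :
  J != finset.set0 -> (forall i, i \in J -> comb_walk (A i) B p w) ->
  comb_walk (fun h => [forall i in J, A i h]) B p w.
Proof.
move=> /set0Pn[i0 Ji0]; elim: w p => //= a w IH p Jw.
apply/andP; split; last by apply: IH => i /Jw /andP[].
have /andP[/and3P[ap Bp Bs] _] := Jw _ Ji0; apply/and3P; split=> //.
move: ap; case: ifP => // ax _; apply/forall_inP => i /Jw /andP[/and3P[]].
by rewrite ax.
Qed.

(** A path visits finitely many states. *)
Lemma comb_walk_bounded A (norm : V -> nat) p w : comb_walk A predT p w ->
  exists M, comb_walk A (fun c => norm c <= M)%N p w.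
Proof.
elim: w p => [|a w IH] p /=; first by exists 0.
move=> /andP[/and3P[ap _ _] /IH[M wM]].
pose M' := maxn M (maxn (norm p.2) (norm (comb_step p a).2)); exists M'.
rewrite /comb_ok ap !leq_max !leqnn !orbT /=.
by apply: comb_walk_sub wM => // c; rewrite !unfold_in leq_max => ->.
Qed.

(** The edges at a state depend on its load through B only, so shifting all
    loads by a period of B changes nothing else. This is what makes the load
    additive on closed paths. *)
Lemma comb_walk_translate A B p d w : (forall c, B (c + d)%R = B c) ->
  comb_walk A B (p.1, p.2 + d)%R w = comb_walk A B p w.
Proof.
move=> Bd; elim: w p => //= a w IH p.
have sE : comb_step (p.1, p.2 + d)%R a =
    ((comb_step p a).1, (comb_step p a).2 + d)%R.
  by rewrite /comb_step; do 2!case: ifP => //= _; rewrite addrAC.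
by rewrite {1}/comb_walk /= sE -/(comb_walk _ _ _ _) IH /comb_ok sE !Bd.
Qed.

Lemma comb_end_translate p d w :
  comb_end (p.1, p.2 + d)%R w = ((comb_end p w).1, (comb_end p w).2 + d)%R.
Proof.
elim: w p => //= a w IH p; rewrite -IH; congr (comb_end _ _).
by rewrite /comb_step; do 2!case: ifP => //= _; rewrite addrAC.
Qed.

Definition comb_loop A B (g : free_group X) : Prop :=
  comb_walk A B (0%N, 0%R) (val g) /\ (comb_end (0%N, 0%R) (val g)).1 = 0%N.

Definition load (g : free_group X) : V := (comb_end (0%N, 0%R) (val g)).2.

(** The load is written as a sum so that the end state is visibly the base
    state shifted by it, as the two translation lemmas require. *)
Lemma comb_loopE A B g : comb_loop A B g ->
  comb_end (0%N, 0%R) (val g) = (0%N, 0 + load g)%R.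
Proof. by case=> _ e0; rewrite add0r [LHS]surjective_pairing e0. Qed.

Lemma comb_loopM A B g g' : (forall c, B (c + load g)%R = B c) ->
  comb_loop A B g -> comb_loop A B g' ->
  comb_loop A B (g * g') /\ load (g * g') = (load g + load g')%R.
Proof.
move=> Bg Lg [wg' eg']; have eg := comb_loopE Lg; case: Lg => wg _.
have [||w e] := walk_foldr_push (@comb_okV A B) (p := (0%N, 0%R)) (u := val g) (v := val g') => //.
  rewrite -/(comb_end _ _) eg [walk _ _ _ _](comb_walk_translate A (0%N, 0%R) _ Bg); exact: wg'.
rewrite /comb_loop /load [val (g * g')]val_free_mul; split; first split => //.
  by rewrite /comb_end e -/comb_end eg (comb_end_translate (0%N, 0%R)).
by rewrite {1}/comb_end e -/comb_end eg (comb_end_translate (0%N, 0%R)) /= addrC add0r.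
Qed.

Lemma comb_loopV A B g : (forall c, B (c + load g)%R = B c) ->
  comb_loop A B g -> comb_loop A B g^-1 /\ load g^-1 = (- load g)%R.
Proof.
move=> Bg Lg; have eg := comb_loopE Lg; case: Lg => wg _.
have [] : comb_walk A B (comb_end (0%N, 0%R) (val g)) (val g^-1) /\
    comb_end (comb_end (0%N, 0%R) (val g)) (val g^-1) = (0%N, 0%R).
  have := walk_winv (@comb_okV A B) wg; exact: id.
rewrite eg (comb_walk_translate A (0%N, 0%R) _ Bg) (comb_end_translate (0%N, 0%R)).
by move=> w [e1 e2]; split; [split | apply: (addIr (load g)); rewrite addNr].
Qed.

(** The subgroups of the proof: w labels a closed path, whose load is tied to
    the second component by E. *)
Definition loop_group (Q : groupType) A B (E : V -> Q -> Prop) :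
    set (free_group X * Q)%type :=
  [set g | comb_loop A B g.1 /\ E (load g.1) g.2].

(** The final load need not be zero, so products involve paths started at
    another load; the last hypothesis asks B to be invariant under the loads
    that occur. *)
Lemma subgroup_loop_group (Q : groupType) A B (E : V -> Q -> Prop) :
  E 0%R 1 -> (forall c v, E c v -> E (- c)%R v^-1) ->
  (forall c v c' v', E c v -> E c' v' -> E (c + c')%R (v * v')) ->
  (forall c v, E c v -> forall d, B (d + c)%R = B d) ->
  subgroup (loop_group A B E).
Proof.
move=> E1 EV EM EB; apply/subgroupP.
split=> [|[g v] [/= gL gE]|[g v] [g' v'] [/= gL gE] [/= gL' gE']].
- by split.
- by have [? e] := comb_loopV (EB _ _ gE) gL; split=> //=; rewrite e; apply: EV.
- by have [? e] := comb_loopM (EB _ _ gE) gL gL'; split=> //=; rewrite e; apply: EM.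
Qed.

(** Schreier's argument with the spanning tree of the y-edges: y^h is the tree
    path to height h, so an edge closed up by tree paths gives y^h x y^-h or
    its inverse for a loop, and 1 for a y-edge. *)
Lemma comb_walk_generated A B (H : set (free_group X)) p w : subgroup H ->
  (forall h, A h -> H (free_gen y ^+ h * free_gen x * free_gen y ^- h)) ->
  comb_walk A B p w ->
  H (free_gen y ^+ p.1 * free_word w * free_gen y ^- (comb_end p w).1).
Proof.
set Y := free_gen y; move=> HG HA; elim: w p => [|a w IH] p /=.
  by rewrite mulg1 mulgV => _; exact: subgroup1 HG.
move=> /andP[/and3P[ap _ _] /IH]; set q := (comb_end _ _).1 => Hw.
pose s := (comb_step p a).1.
have -> : Y ^+ p.1 * (free_letter a * free_word w) * Y ^- q =
   (Y ^+ p.1 * free_letter a * Y ^- s) * (Y ^+ s * free_word w * Y ^- q).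
  by rewrite !mulgA mulgVK.
apply: subgroupM (Hw) => //; rewrite {}/s {Hw}/free_letter.
clear q; case: p a ap => h c [t b]; rewrite /comb_step /=; case: eqP => [->|_].
  move=> /HA Hh; case: b => //=; rewrite -/Y in Hh *.
  have := subgroupV HG Hh; by rewrite !invgM invgK mulgA.
move=> /andP[/eqP-> hb]; rewrite -/Y; case: b hb => /= hb.
  by case: h hb => //= h _; rewrite expgSr mulgK mulgV; exact: subgroup1 HG.
by rewrite -expgSr mulgV; exact: subgroup1 HG.
Qed.
End Comb.

Section CombWords.
Variables (X : choiceType) (x y : X) (xy : x != y).
Variables (V : zmodType) (wt : nat -> V).
Implicit Types (A : pred nat) (B : pred V) (p : nat * V).

(** Loops may be tested on unreduced words. *)
Lemma comb_loop_word A B c w :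
  comb_walk x y wt A B (0%N, 0%R) w -> comb_end x wt (0%N, 0%R) w = (0%N, c) ->
  comb_loop x y wt A B (free_word w) /\ load x wt (free_word w) = c.
Proof.
move=> ww ew; have [w1 e1] := walk_foldr_push (@comb_okV _ x y _ wt A B) ww (v := [::]) isT.
have {}e1 : comb_end x wt (0%N, 0%R) (reduce w) = (0%N, c) by rewrite -ew; exact: e1.
by rewrite /comb_loop /load val_free_word e1.
Qed.

Definition comb_walks A p w q := comb_walk x y wt A predT p w /\ comb_end x wt p w = q.

Lemma comb_up A j h (c : V) :
  comb_walks A (h, c) (nseq j (y, false)) ((h + j)%N, c).
Proof.
rewrite /comb_walks; elim: j h => [|j IH] h; first by rewrite addn0.
have [w e] := IH h.+1; rewrite addSnnS in e.
have sE : comb_step x wt (h, c) (y, false) = (h.+1, c).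
  by rewrite /comb_step /= eq_sym (negbTE xy).
split; last by rewrite /comb_end /= sE.
by rewrite /comb_walk /= /comb_ok sE /= eq_sym (negbTE xy) eqxx.
Qed.

Lemma comb_down A j h (c : V) :
  comb_walks A ((h + j)%N, c) (nseq j (y, true)) (h, c).
Proof.
rewrite /comb_walks; elim: j => [|j [w e]]; first by rewrite addn0.
have sE : comb_step x wt ((h + j.+1)%N, c) (y, true) = ((h + j)%N, c).
  by rewrite /comb_step /= eq_sym (negbTE xy) addnS.
split; last by rewrite /comb_end /= sE.
by rewrite /comb_walk /= /comb_ok sE /= eq_sym (negbTE xy) eqxx addnS.
Qed.

Lemma comb_around A j h (c : V) b : A h ->
  comb_walks A (h, c) (nseq j (x, b))
    (h, if b then c - wt h *+ j else c + wt h *+ j)%R.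
Proof.
move=> Ah; rewrite /comb_walks; elim: j c => [|j IH] c.
  by rewrite !mulr0n subr0 addr0 if_same.
have := IH (if b then c - wt h else c + wt h)%R.
have sE : comb_step x wt (h, c) (x, b) = (h, if b then c - wt h else c + wt h)%R.
  by rewrite /comb_step /= eqxx.
rewrite /comb_walk /comb_end /= /comb_ok !sE /= eqxx Ah => -[-> ->].
by split=> //; congr pair; case: b {IH sE}; rewrite mulrS ?opprD addrA.
Qed.

Lemma comb_walks_cat A p u q v r :
  comb_walks A p u q -> comb_walks A q v r -> comb_walks A p (u ++ v) r.
Proof.
move=> [wu eu] [wv ev]; split; last by rewrite /comb_end foldl_cat -!/(comb_end _ _ _) eu.
by rewrite /comb_walk walk_cat; apply/andP; split; rewrite // -/(comb_end _ _ _) eu.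
Qed.

Lemma comb_tooth A h : A h ->
  comb_loop x y wt A predT (free_gen y ^+ h * free_gen x * free_gen y ^- h).
Proof.
move=> Ah.
have [wl el] : comb_walks A (0%N, 0%R)
    (nseq h (y, false) ++ nseq 1 (x, false) ++ nseq h (y, true)) (0%N, 0 + wt h *+ 1)%R.
  apply: comb_walks_cat (comb_up A _ 0 _) _.
  exact: comb_walks_cat (comb_around _ _ _ Ah) (comb_down A h 0 _).
have [] := comb_loop_word wl el.
by rewrite !free_word_cat !free_word_nseq /free_letter /= mulgA expVgn expg1.
Qed.

(** Finitely many loops give finitely many Schreier generators. *)
Lemma finitely_generated_comb A N : (forall h, A h -> (h <= N)%N) ->
  finitely_generated [set g : free_group X | comb_loop x y wt A predT g].
Proof.
move=> AN; set H := [set g | _].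
have HG : subgroup H.
  apply/subgroupP; split=> [//|g|g g'] /= Hg; first by case: (comb_loopV _ Hg).
  by move=> Hg'; case: (comb_loopM _ Hg Hg').
pose f h := free_gen y ^+ h * free_gen x * free_gen y ^- h.
apply: (@finitely_generatedP _ (f @` [set h | A h])) => //.
- apply: finite_image; apply: (sub_finite_set (B := `I_N.+1)) => // h /AN.
- by move=> _ [h Ah <-]; apply: comb_tooth.
move=> g [wg eg].
have := comb_walk_generated (H := generated (f @` [set h | A h])) (subgroup_generated _) _ wg.
rewrite eg expg0 invg1 mul1g mulg1 free_word_val; apply=> h Ah.
by apply: mem_generated; exists h.
Qed.

(** The word t^N x t^-N for t = y^s x y^-s: its total load is the weight at
    height 0, but on the way the load reaches N times the weight at height s. *)
Definition zigzag s N : seq (X * bool) :=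
  nseq s (y, false) ++ nseq N (x, false) ++ nseq s (y, true) ++ nseq 1 (x, false) ++
  nseq s (y, false) ++ nseq N (x, true) ++ nseq s (y, true) ++ [::].

Lemma reduced_zigzag s N : (0 < s)%N -> (0 < N)%N -> reduced (zigzag s N).
Proof.
case: s N => // s [//|N] _ _.
by do 7!(apply: reduced_nseq_cat; last
  by rewrite /= /flip xpair_eqE /= ?andbF ?(negbTE xy) 1?eq_sym ?(negbTE xy)).
Qed.

Lemma comb_walks_zigzag A s N : A 0%N -> A s ->
  comb_walks A (0%N, 0%R) (zigzag s N) (0%N, wt 0).
Proof.
move=> A0 As; rewrite /zigzag.
apply: comb_walks_cat (comb_up A _ 0 _) _.
apply: comb_walks_cat (comb_around _ _ _ As) _.
apply: comb_walks_cat (comb_down A s 0 _) _.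
apply: comb_walks_cat (comb_around _ _ _ A0) _.
apply: comb_walks_cat (comb_up A _ 0 _) _.
apply: comb_walks_cat (comb_around _ _ _ As) _.
apply: comb_walks_cat (comb_down A s 0 _) _.
by split=> //=; rewrite add0r mulr1n addrAC subrr add0r.
Qed.

(** The prefix y^s x^N of the word ends with load [wt s *+ N]. *)
Lemma comb_walk_zigzag_load A B s N : A s -> (0 < s)%N ->
  comb_walk x y wt A B (0%N, 0%R) (zigzag s N) -> B (wt s *+ N)%R.
Proof.
move=> As; case: s As => // s As _.
rewrite /zigzag catA /comb_walk walk_cat => /andP[_] /=.
have [_] := comb_walks_cat (comb_up A s.+1 0 0%R) (comb_around N 0%R false As).
rewrite add0r /= => e; rewrite -/(comb_end _ _ _) e.
by case/andP=> /and3P[].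
Qed.

End CombWords.

(** * Coordinates of Z^m *)

(** Each element of D is given its own coordinate of Z^m. The functionals rho
    are indexed by all of T, so that no membership proof is needed to form one;
    only those at the elements of D can be prescribed. *)
Lemma coordinates_on (T : finType) (D : {set T}) m : (#|D| <= m)%N ->
  exists rho : T -> 'rV[int]_m -> int,
    [/\ forall t, rho t 0%R = 0%R,
        forall t (v : 'rV[int]_m), rho t (- v)%R = (- rho t v)%R,
        forall t (v w : 'rV[int]_m), rho t (v + w)%R = (rho t v + rho t w)%R &
        forall f : T -> int, exists v, forall t, t \in D -> rho t v = f t].
Proof.
move=> Dm; pose is_slot (j : 'I_m) t := (t \in D) && (index t (enum D) == j).
exists (fun t v => \sum_(j | is_slot j t) v ord0 j)%R; split.
- by move=> t; apply: big1 => j _; rewrite mxE.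
- by move=> t v; rewrite -sumrN; apply: eq_bigr => j _; rewrite mxE.
- by move=> t v w; rewrite -big_split; apply: eq_bigr => j _; rewrite mxE.
move=> f; exists (\row_j \sum_(t | is_slot j t) f t)%R => t Dt.
have tm : (index t (enum D) < m)%N.
  by apply: leq_trans Dm; rewrite cardE index_mem mem_enum.
rewrite (bigD1 (Ordinal tm)) /= /is_slot ?Dt ?eqxx //= big1 ?addr0 => [|j]; last first.
  by case/andP=> /eqP tj /eqP[]; apply/val_inj.
rewrite mxE (bigD1 t) /= ?Dt ?eqxx //= big1 ?addr0 // => u.
case/andP=> /andP[Du /eqP ut] /eqP[].
by rewrite -[u](nth_index t (s := enum D)) ?mem_enum // ut nth_index ?mem_enum.
Qed.

(** * The witnessing subgroups *)

Section Configuration.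
Variables (k : nat) (II : {set nonempty_subset k}).
Variables (X : choiceType) (x y : X) (xy : x != y) (m : nat).

Local Notation T := (nonempty_subset k).
Local Notation V := {ffun T -> int}.

Definition tip (I : T) : 'I_k := xchoose (set0Pn _ (valP I)).

Lemma tipP (I : T) : tip I \in val I.
Proof. exact: xchooseP. Qed.

(** The pairs (I, i) that own a coordinate of Z^m. *)
Definition slots : {set T * 'I_k} :=
  [set t : T * 'I_k | (t.1 \in II) && (t.2 \in val t.1 :\ tip t.1)].

Lemma card_slots : #|slots| = (\sum_(I in II) (#|val I| - 1))%N.
Proof.
rewrite -sum1_card (eq_bigl (fun t : T * 'I_k => (t.1 \in II) && (t.2 \in val t.1 :\ tip t.1))).
  rewrite -(pair_big_dep (fun I => I \in II) (fun I i => i \in val I :\ tip I) (fun _ _ => 1%N)).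
  by apply: eq_bigr => I _; rewrite sum1_card [in RHS](cardsD1 (tip I)) tipP addKn.
by move=> t; rewrite inE.
Qed.

(** Heights start at 1: the loop at height 0 has no weight, and provides the
    second free generator that the intersection over J in II needs. *)
Definition tooth_height (I : T) : nat := (enum_rank I).+1.

Lemma tooth_height_inj : injective tooth_height.
Proof. by move=> I J [/val_inj/enum_rank_inj]. Qed.

Definition weight (h : nat) : V := [ffun I => (h == tooth_height I)%:R]%R.

(** The loops allowed for the i-th subgroup: those not attached to a subset
    missing i; the bound keeps their number finite. *)
Definition teeth (i : 'I_k) : pred nat := fun h =>
  (h <= #|{: T}|)%N && [forall I : T, (h == tooth_height I) ==> (i \in val I)].

Variable rho : T * 'I_k -> 'rV[int]_m -> int.
Hypotheses (rho0 : forall t, rho t 0%R = 0%R)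
  (rhoN : forall t (v : 'rV[int]_m), rho t (- v)%R = (- rho t v)%R)
  (rhoD : forall t (v w : 'rV[int]_m), rho t (v + w)%R = (rho t v + rho t w)%R)
  (rho_surj : forall f : T * 'I_k -> int,
     exists v, forall t, t \in slots -> rho t v = f t).

Definition constraint (i : 'I_k) (c : V) (v : 'rV[int]_m) : Prop :=
  forall I : T, I \in II -> i \in val I ->
    if i == tip I then c I = (\sum_(j in val I :\ tip I) rho (I, j) v)%R
    else rho (I, i) v = 0%R.

Local Notation F := (free_group X).
Local Notation Q := (mult 'rV[int]_m).

Definition witness (i : 'I_k) : set (F * Q)%type :=
  loop_group x y weight (teeth i) predT (constraint i : V -> Q -> Prop).

Lemma constraint_closed i :
  [/\ constraint i 0%R 0%R,
      forall c v, constraint i c v -> constraint i (- c)%R (- v)%R &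
      forall c v c' v', constraint i c v -> constraint i c' v' ->
        constraint i (c + c')%R (v + v')%R].
Proof.
split=> [I _ _|c v cv I III iI|c v c' v' cv cv' I III iI].
- by case: ifP => _; rewrite ?rho0 // ffunE big1.
- have := cv I III iI; case: ifP => _ e; rewrite ?rhoN ?e ?oppr0 //.
  by rewrite ffunE e -sumrN; apply: eq_bigr => j _; rewrite rhoN.
have := cv I III iI; have := cv' I III iI.
case: ifP => _ e' e; last by rewrite rhoD e e' addr0.
by rewrite ffunE e e' -big_split; apply: eq_bigr => j _; rewrite rhoD.
Qed.

Lemma subgroup_witness i : subgroup (witness i).
Proof.
have [c0 cN cD] := constraint_closed i.
by apply: subgroup_loop_group.
Qed.

Definition common_teeth (J : T) : pred nat :=
  fun h => [forall i in val J, teeth i h].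

Lemma bigcap_witness (J : T) :
  (\bigcap_(i in [set` val J]) witness i) =
  loop_group x y weight (common_teeth J) predT
    ((fun c v => forall i, i \in val J -> constraint i c v) : V -> Q -> Prop).
Proof.
apply/seteqP; split=> [g Hg|g [[wg eg] Eg] i Ji]; last first.
  split; last exact: Eg.
  split=> //; apply: comb_walk_sub wg => // h.
  by rewrite !unfold_in => /forall_inP; apply.
split=> [|i Ji]; last by case: (Hg i Ji).
split; last by case: (Hg _ (tipP J)) => -[].
by apply: (comb_walk_forall (valP J)) => i Ji; case: (Hg i Ji) => -[].
Qed.

Lemma common_teeth_le J h : common_teeth J h -> (h <= #|{: T}|)%N.
Proof. by move=> /forall_inP/(_ _ (tipP J))/andP[]. Qed.

Lemma common_teeth0 J : common_teeth J 0%N.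
Proof. by apply/forall_inP => i _; apply/forallP. Qed.

Lemma common_teeth_tooth (J I : T) :
  common_teeth J (tooth_height I) = (val J \subset val I).
Proof.
apply/forall_inP/fintype.subsetP => [JI i /JI/andP[_ /forallP/(_ I)]|JI i /JI iI].
  by rewrite eqxx.
apply/andP; split; first exact: ltn_ord.
by apply/forallP => I'; apply/implyP => /eqP/tooth_height_inj <-.
Qed.

(** The I-component of the load changes only at the loop of I. *)
Lemma load_uncommon (I : T) (A : pred nat) B p w : ~~ A (tooth_height I) ->
  comb_walk x y weight A B p w -> (comb_end x weight p w).2 I = p.2 I.
Proof.
move=> AI; elim: w p => //= a w IH p /andP[/and3P[ap _ _] /IH->].
move: ap; rewrite /comb_step; case: ifP => //= _ Ap.
have w0 : weight p.1 I = 0%R.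
  by rewrite ffunE; case: eqP Ap => // -> ; rewrite (negbTE AI).
case: ifP => _; rewrite [LHS]ffunE; last by rewrite w0 addr0.
by rewrite [X in (_ + X)%R]ffunE w0 subr0.
Qed.

Lemma subgroup_bigcap_witness (J : T) :
  subgroup (\bigcap_(i in [set` val J]) witness i).
Proof. by apply: subgroup_bigcap => i _; apply: subgroup_witness. Qed.

(** If some r in I lies outside J, the whole load of I is put on the coordinate
    of (I, r): it is unconstrained by J, and it enters the equation of the tip.
    When r is itself the tip, it owns no coordinate, but then the equation of
    the tip is not imposed and v = 0 works. If I is contained in J, then I
    differs from J and the hypothesis makes its load vanish. *)
Lemma solve_constraints (J : T) (c : V) : J \notin II ->
  (forall I : T, ~~ (val J \subset val I) -> c I = 0%R) ->
  exists v, forall i, i \in val J -> constraint i c v.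
Proof.
move=> JII c0.
pose f (t : T * 'I_k) : int :=
  if [pick r in val t.1 :\: val J] == Some t.2 then c t.1 else 0%R.
have [v vf] := rho_surj f; exists v => i Ji I III Ii.
have slotP j : j \in val I :\ tip I -> rho (I, j) v = f (I, j).
  by move=> jI; apply: vf; rewrite inE III jI.
case: eqP => [it|/eqP it]; last first.
  rewrite slotP ?inE ?it ?Ii // /f /=; case: pickP => // r; rewrite inE => /andP[rJ _].
  by case: eqP => // -[ri]; rewrite ri Ji in rJ.
rewrite (eq_bigr (fun j => f (I, j))) => [|j /slotP//].
rewrite /f /=; case: pickP => [r|IJ].
  rewrite inE => /andP[rJ rI]; have rt : r != tip I.
    by apply: contraNneq rJ => ->; rewrite -it.
  rewrite (bigD1 r) ?inE ?rt ?rI //= eqxx big1 ?addr0 // => j /andP[_ jr].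
  by rewrite ifF //; apply/eqP => -[rj]; rewrite rj eqxx in jr.
rewrite big1 //; apply: c0; apply: contra JII => JI.
suff -> : J = I by [].
apply/val_inj/eqP; rewrite finset.eqEsubset JI /=; apply/fintype.subsetP => j jI.
by have := IJ j; rewrite inE jI andbT => /negbFE.
Qed.

(** By [solve_constraints] the first projection is the full group of closed
    paths in the comb with the common teeth. *)
Lemma bigcap_witness_fg (J : T) : J \notin II ->
  finitely_generated (\bigcap_(i in [set` val J]) witness i).
Proof.
move=> JII; apply: finitely_generated_times_row; first exact: subgroup_bigcap_witness.
rewrite bigcap_witness.
suff -> : fst @` loop_group x y weight (common_teeth J) predT
    ((fun c v => forall i, i \in val J -> constraint i c v) : V -> Q -> Prop) =
    [set g | comb_loop x y weight (common_teeth J) predT g].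
  by apply: (finitely_generated_comb xy) => h; apply: common_teeth_le.
apply/seteqP; split=> [_ [g [? _] <-] //|g gL].
have [|v gv] := solve_constraints (c := load x weight g) JII; last by exists (g, v).
move=> I; rewrite -common_teeth_tooth => JI; case: gL => gL _.
by rewrite /load (load_uncommon (I := I) JI gL) ffunE.
Qed.

(** The J-component of the load of an element is 0, being the sum of the
    coordinates of J, which all vanish. So the groups U M of paths along which
    this component stays in [-M, M] exhaust the intersection, while the zigzag
    with exponent M + 1 lies in it but not in U M. *)
Lemma bigcap_witness_not_fg (J : T) : J \in II ->
  ~ finitely_generated (\bigcap_(i in [set` val J]) witness i).
Proof.
move=> JII; rewrite bigcap_witness.
pose U M : set (F * Q)%type := loop_group x y weight (common_teeth J)
  (fun c => `|c J| <= M)%N (fun c _ => c J = 0%R).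
apply: (union_of_chain_not_fg (U := U)) => [M|M N MN [g v]|[g v]|M].
- apply: subgroup_loop_group => [|c _ /= cJ|c _ c' _ /= cJ cJ'|c _ /= cJ d].
  + by rewrite ffunE.
  + by rewrite ffunE cJ oppr0.
  + by rewrite ffunE cJ cJ' addr0.
  + by rewrite ffunE cJ addr0.
- move=> [[/= wg eg] cg]; split=> //; split=> //.
  by apply: comb_walk_sub wg => // c; rewrite !unfold_in => /leq_trans; apply.
- move=> [[/= wg eg] Eg].
  have [M wM] := comb_walk_bounded (fun c : V => `|c J|%N) wg; exists M => //.
  split; [by split | rewrite /=].
  have := Eg _ (tipP J) J JII (tipP J); rewrite eqxx => ->; apply: big1 => j.
  rewrite inE => /andP[]; rewrite inE => jt jJ.
  by have := Eg j jJ J JII jJ; rewrite (negbTE jt).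
move=> HU; set s := tooth_height J.
have As : common_teeth J s by rewrite common_teeth_tooth.
have w0 : weight 0 = 0%R by apply/ffunP => I; rewrite !ffunE.
have [wz ez] := comb_walks_zigzag xy weight M.+1 (common_teeth0 J) As.
have [Lz lz] := comb_loop_word wz ez.
have [[wU _] _] : U M (free_word (zigzag x y s M.+1), 0%R : 'rV[int]_m).
  apply: HU; split=> // i Ji /=; rewrite lz w0.
  by have [] := constraint_closed i.
rewrite val_free_word (reduce_id (reduced_zigzag xy _ _)) // in wU.
have /= := comb_walk_zigzag_load xy As isT wU.
by rewrite ffunMnE ffunE eqxx [(_ *+ M.+1)%R]natz ltnn.
Qed.
End Configuration.

Theorem theorem5p5 (k : nat) (hk : (1 <= k)%N) (II : {set nonempty_subset k})
    (n m : nat) (hn : (2 <= n)%N)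
    (hm : (\sum_(I in II) (#|val I| - 1) <= m)%N) :
  realizable (FZ n m) (chi II).
Proof.
have xy : Ordinal (ltnW hn) != Ordinal hn by [].
have [|rho [rho0 rhoN rhoD rho_surj]] := @coordinates_on _ (slots II) m.
  by rewrite card_slots.
exists (witness II (Ordinal (ltnW hn)) (Ordinal hn) rho) => [i|I /=].
  exact: subgroup_witness.
rewrite /chi; case: ifP => [III|/negbT nIII].
  exact: bigcap_witness_not_fg.
exact: bigcap_witness_fg.
Qed.
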